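(* Let $G$ be an abelian group and $\underline{g}=(g_1,\dots,g_m)\in G^m$. Let $\mathcal{A}(\mathcal{B}(\mathrm{supp}(\underline{g})))=\{a_1,\dots,a_n\}$ with $|a_1|\ge|a_2|\ge\cdots\ge|a_n|$, and $r=r(\mathcal{B}(\mathrm{supp}(\underline{g})))$. Then: (i) $c_{\mathrm{gr}}(\mathcal{B}(\underline{g}))\le\max\{2|a_1|,\ c_{\mathrm{gr}}(\mathcal{B}(\mathrm{supp}(\underline{g})))\}$ and $c_{\mathrm{gr}}(\mathcal{B}(\mathrm{supp}(\underline{g})))\le\sum_{i=1}^{\min\{n,r+1\}}|a_i|-r$; (ii) if $g_1,\dots,g_m$ generate a finite subgroup of $G$, then $c_{\mathrm{gr}}(\mathcal{B}(\underline{g}))\le2\,\mathsf{d}(\mathrm{supp}(\underline{g}))+2$.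
   Context: $G$ is written multiplicatively. $\mathcal{B}(\underline{g})=\{\alpha\in\mathbb{N}_0^m\mid\prod_ig_i^{\alpha_i}=1\}$, $\mathrm{supp}(\underline{g})=\{g_1,\dots,g_m\}$, and for finite $G_0\subseteq G$, $\mathcal{B}(G_0)=\{\alpha\in\mathbb{N}_0^{G_0}\mid\prod_{g\in G_0}g^{\alpha(g)}=1\}$. These monoids are graded by total degree $|\alpha|=\sum\alpha_i$ (resp. $\sum_g\alpha(g)$); they are connected graded reduced affine monoids with finite atom sets $\mathcal{A}(\cdot)$. For such a monoid $T$ (written additively): for $\alpha,\gamma\in\mathbb{N}_0^{\mathcal{A}(T)}$ let $a^{\alpha}=\sum_a\alpha(a)a\in T$, $|\alpha|_{\mathrm{gr}}=\sum_a\alpha(a)|a|$, $\gcd(\alpha,\gamma)(a)=\min\{\alpha(a),\gamma(a)\}$, $d_{\mathrm{gr}}(\alpha,\gamma)=\max\{|\alpha-\gcd|_{\mathrm{gr}},|\gamma-\gcd|_{\mathrm{gr}}\}$; the graded catenary degree $c_{\mathrm{gr}}(T)$ is the minimal $d$ such that whenever $a^{\alpha}=a^{\gamma}$ there is a sequence $\alpha=\alpha^{(0)},\dots,\alpha^{(k)}=\gamma$ with $a^{\alpha^{(j)}}=a^{\alpha^{(j+1)}}$ and $d_{\mathrm{gr}}(\alpha^{(j)},\alpha^{(j+1)})\le d$. $r(T)$ is the rank of the subgroup of the ambient free abelian group $\mathbb{Z}^{\mathrm{supp}(\underline{g})}$ generated by $T$. For a finite subset $G_0$ of a finite abelian group,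 the little Davenport constant $\mathsf{d}(G_0)$ is the maximal $|\alpha|$, $\alpha\in\mathbb{N}_0^{G_0}$, such that for every atom $\gamma$ of $\mathcal{B}(G_0)$ there is $g\in G_0$ with $\gamma(g)>\alpha(g)$ (the maximal length of a sequence over $G_0$ with no nonempty product-one subsequence). *)

(* Defs.v *)
(* The abelian group G is an additive [zmodType]
   (the paper writes G multiplicatively; product g^a becomes sum a *+ g). *)
From Stdlib Require Import ClassicalEpsilon.
From mathcomp Require Import all_boot all_algebra.

Set Implicit Arguments.
Unset Strict Implicit.
Unset Printing Implicit Defensive.

Notation vec k := {ffun 'I_k -> nat}.

Definition vzero k : vec k := [ffun => 0%N].
Definition vadd k (a b : vec k) : vec k := [ffun i => a i + b i].

Definition vdeg k (a : vec k) : nat := \sum_i a i.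

Definition inB (G : zmodType) k (h : 'I_k -> G) (a : vec k) : bool :=
  (\sum_i h i *+ a i == 0)%R.

Definition is_atom (G : zmodType) k (h : 'I_k -> G) (a : vec k) : Prop :=
  [/\ inB h a, a != vzero k &
      ~ exists b c, [/\ inB h b, inB h c, b != vzero k, c != vzero k
                      & a = vadd b c]].

(* A factorization alpha in N_0^{A(B(h))} is represented as a finite multiset
   (sequence, order irrelevant) of atoms; a^alpha is the sum of its elements. *)
Definition is_fact (G : zmodType) k (h : 'I_k -> G) (z : seq (vec k)) : Prop :=
  forall x, x \in z -> is_atom h x.

Definition fsum k (z : seq (vec k)) : vec k := [ffun j => \sum_(x <- z) x j].

(* |alpha - gcd(alpha,gamma)|_gr *)
Definition dgr_half k (z z' : seq (vec k)) : nat :=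
  \sum_(x <- undup (z ++ z')) (count_mem x z - count_mem x z') * vdeg x.

Definition dgr k (z z' : seq (vec k)) : nat := maxn (dgr_half z z') (dgr_half z' z).

Definition cat_ok (G : zmodType) k (h : 'I_k -> G) (d : nat) : Prop :=
  forall z z', is_fact h z -> is_fact h z' -> fsum z = fsum z' ->
  exists ch : seq (seq (vec k)),
    [/\ forall y, y \in ch -> is_fact h y /\ fsum y = fsum z,
        last z ch = z'
      & path (fun x y => dgr x y <= d) z ch].

Definition cat_okb (G : zmodType) k (h : 'I_k -> G) (d : nat) : bool :=
  if excluded_middle_informative (cat_ok h d) then true else false.

(* c_gr(B(h)) : the minimal such d (0 if none exists; it always exists here) *)
Definition c_gr (G : zmodType) k (h : 'I_k -> G) : nat :=
  match excluded_middle_informative (exists d, cat_okb h d) with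
  | left H => ex_minn H
  | right _ => 0%N
  end.

Definition supp (G : zmodType) m (g : 'I_m -> G) : seq G := undup (codom g).
Definition suppf (G : zmodType) m (g : 'I_m -> G) : 'I_(size (supp g)) -> G :=
  fun i => nth 0%R (supp g) i.

Definition in_Zspan (G : zmodType) k (h : 'I_k -> G) (x : 'I_k -> int) : Prop :=
  exists s : seq (vec k * int),
    (forall p, p \in s -> inB h p.1) /\
    (forall j, (x j = \sum_(p <- s) p.2 * (p.1 j)%:Z)%R).

Definition Zindep k s (v : 'I_s -> 'I_k -> int) : Prop :=
  forall c : 'I_s -> int, (forall j, (\sum_i c i * v i j = 0)%R) ->
  forall i, c i = 0%R.

Definition is_rank (G : zmodType) k (h : 'I_k -> G) (r : nat) : Prop :=
  (exists v : 'I_r -> 'I_k -> int, (forall i, in_Zspan h (v i)) /\ Zindep v) /\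
  (forall v : 'I_r.+1 -> 'I_k -> int, (forall i, in_Zspan h (v i)) -> ~ Zindep v).

Definition dav_ok (G : zmodType) k (h : 'I_k -> G) (a : vec k) : Prop :=
  forall c, is_atom h c -> exists i, a i < c i.

Definition is_davenport (G : zmodType) k (h : 'I_k -> G) (D : nat) : Prop :=
  (exists a, dav_ok h a /\ vdeg a = D) /\ (forall a, dav_ok h a -> vdeg a <= D).

Definition gen_finite (G : zmodType) m (g : 'I_m -> G) : Prop :=
  exists s : seq G, forall z : 'I_m -> int, (\sum_i g i *~ z i)%R \in s.
Arguments suppf [G m] g _.

(* Main.v *)
(** For [b] in the monoid, join two atoms [a], [a'] below [b] when [a + a' <= b];
    the graded catenary degree is at most [d] once this graph is connected for
    every [b] of degree greater than [d].

    For the bound by the rank, consider the polytope of all rational [x >= 0]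
    with [\sum_i x_i a_i = b].  The monoid consists of the nonnegative vectors of
    a group, so for each [x] the atoms with [x_i >= 1] are pairwise joined, and it
    suffices that along every edge of the polytope some [x_i >= 1] persists.  An
    edge is supported on a set [S] of atoms satisfying at most one linear relation;
    if all [x_i < 1], then [\sum_(i in S) a_i - b] is positive on the at least
    [#|S| - 1] coordinates met by [S], so that [deg b] is at most
    [\sum_(i in S) deg a_i - (#|S| - 1)], where [#|S| <= r + 1].  The simplex
    method connects any two vertices of the polytope by edges.

    For the Davenport bound the graph is connected because the Kneser graph of the
    submultisets of size [D + 1] of a multiset of size at least [2 D + 3] is.

    Passing from the support to [g], a chain is lifted step by step; what remains
    is to move units along fibres, which changes two atoms at a time. *)
From Stdlib Require Import Classical ClassicalEpsilon.
Require Import Defs.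
From mathcomp Require Import all_boot all_order all_algebra.
From mathcomp Require Import zify lra.

Set Implicit Arguments.
Unset Strict Implicit.
Unset Printing Implicit Defensive.

(** Classical truth values make reachability and the existence of a vertex usable as boolean
    predicates. The body agrees with that of [cat_okb], so [decbP] applies there too. *)
Definition decb (P : Prop) : bool :=
  if excluded_middle_informative P then true else false.

Lemma decbP (P : Prop) : reflect P (decb P).
Proof. by rewrite /decb; case: excluded_middle_informative => H; constructor. Qed.

(** * Vectors and multisets of vectors *)

Section Vectors.
Variable k : nat.
Implicit Types (a b c x y : vec k) (z w u v : seq (vec k)).

Definition vle a b : bool := [forall i, a i <= b i].
Definition vsub a b : vec k := [ffun i => a i - b i].
Definition vunit (i : 'I_k) : vec k := [ffun j => (j == i : nat)].

Lemma vleP a b : reflect (forall i, a i <= b i) (vle a b).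
Proof. exact: forallP. Qed.

Lemma vle_trans b a c : vle a b -> vle b c -> vle a c.
Proof. move=> /vleP ab /vleP bc; apply/vleP => i; exact: leq_trans (ab i) (bc i). Qed.

Lemma vle_addr a b : vle a (vadd a b).
Proof. by apply/vleP => i; rewrite ffunE leq_addr. Qed.

Lemma vaddC a b : vadd a b = vadd b a.
Proof. by apply/ffunP => i; rewrite !ffunE addnC. Qed.

Lemma vaddA a b c : vadd a (vadd b c) = vadd (vadd a b) c.
Proof. by apply/ffunP => i; rewrite !ffunE addnA. Qed.

Lemma vadd_inj a : injective (vadd a).
Proof.
move=> b c /ffunP E; apply/ffunP => i; have := E i.
by rewrite !ffunE => /addnI.
Qed.

Lemma vsubK a b : vle a b -> vadd a (vsub b a) = b.
Proof. by move=> /vleP ab; apply/ffunP => i; rewrite !ffunE subnKC. Qed.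

Lemma vdeg_add a b : vdeg (vadd a b) = vdeg a + vdeg b.
Proof.
by rewrite /vdeg -big_split /=; apply: eq_bigr => i _; rewrite ffunE.
Qed.

Lemma vdeg_eq0 a : (vdeg a == 0) = (a == vzero k).
Proof.
rewrite /vdeg sum_nat_eq0; apply/forall_inP/eqP => [H | -> i _]; last by rewrite ffunE.
by apply/ffunP => i; rewrite ffunE; apply/eqP/H.
Qed.

Lemma vdeg0 : vdeg (vzero k) = 0.
Proof. by apply/eqP; rewrite vdeg_eq0. Qed.

Lemma vdeg_unit i : vdeg (vunit i) = 1.
Proof.
rewrite /vdeg (bigD1 i) //= ffunE eqxx big1 // => j /negbTE E.
by rewrite ffunE E.
Qed.

Lemma vdeg_le a b : vle a b -> vdeg a <= vdeg b.
Proof. by move=> /vleP ab; apply: leq_sum => i _. Qed.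

Lemma vle_deg_eq a b : vle a b -> vdeg b <= vdeg a -> a = b.
Proof.
move=> ab; rewrite -{1}(vsubK ab) vdeg_add => le.
have /eqP : vdeg (vsub b a) = 0 by lia.
rewrite vdeg_eq0 => /eqP E; rewrite -(vsubK ab) E.
by apply/ffunP => i; rewrite !ffunE addn0.
Qed.

Lemma fsum_nil : fsum [::] = vzero k.
Proof. by apply/ffunP => i; rewrite !ffunE big_nil. Qed.

Lemma fsum_cons x z : fsum (x :: z) = vadd x (fsum z).
Proof. by apply/ffunP => i; rewrite !ffunE big_cons. Qed.

Lemma fsum_cat z w : fsum (z ++ w) = vadd (fsum z) (fsum w).
Proof. by apply/ffunP => i; rewrite !ffunE big_cat. Qed.

Lemma fsum_perm z w : perm_eq z w -> fsum z = fsum w.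
Proof. by move=> zw; apply/ffunP => i; rewrite !ffunE (perm_big _ zw). Qed.

Lemma vdeg_fsum z : vdeg (fsum z) = \sum_(x <- z) vdeg x.
Proof.
elim: z => [|x z IH]; first by rewrite fsum_nil big_nil vdeg0.
by rewrite fsum_cons vdeg_add big_cons IH.
Qed.

Lemma vle_fsum x z : x \in z -> vle x (fsum z).
Proof.
by move=> xz; rewrite (fsum_perm (perm_to_rem xz)) fsum_cons vle_addr.
Qed.

(** This is [z] minus the gcd of [z] and [w]; hence [msub z (msub z w)] represents the gcd
    itself. *)
Definition msub z w : seq (vec k) := foldr (fun x s => rem x s) z w.

Lemma count_msub x z w : count_mem x (msub z w) = count_mem x z - count_mem x w.
Proof.
elim: w => [|y w IH] /=; first by rewrite subn0.
rewrite count_rem IH -has_pred1 has_count /=.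
by case: (eqVneq y x) => [->|_]; rewrite ?IH /= ?andbT ?andbF; lia.
Qed.

Lemma perm_count z w : (forall x, count_mem x z = count_mem x w) -> perm_eq z w.
Proof. by move=> E; apply/allP => x _; rewrite /= E. Qed.

Lemma msub_split z w : perm_eq z (msub z (msub z w) ++ msub z w).
Proof. apply: perm_count => x; rewrite count_cat !count_msub; lia. Qed.

Lemma msub_common z w : perm_eq (msub z (msub z w)) (msub w (msub w z)).
Proof. apply: perm_count => x; rewrite !count_msub; lia. Qed.

Lemma sum_count (F : vec k -> nat) z s :
  uniq s -> {subset z <= s} ->
  \sum_(x <- s) count_mem x z * F x = \sum_(x <- z) F x.
Proof.
move=> us; elim: z => [|y z IH] zs.
  by rewrite big_nil big1.
rewrite big_cons -IH; last by move=> t tz; apply: zs; rewrite inE tz orbT.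
under eq_bigr => x _ do rewrite /= mulnDl.
rewrite big_split /=; congr (_ + _).
rewrite (bigD1_seq y) //=; last by apply: zs; rewrite mem_head.
rewrite eqxx mul1n big1 ?addn0 // => x /negbTE.
by rewrite eq_sym => ->.
Qed.

Lemma dgr_half_msub z w : dgr_half z w = vdeg (fsum (msub z w)).
Proof.
rewrite vdeg_fsum -(@sum_count (@vdeg k) (msub z w) (undup (z ++ w))) ?undup_uniq //.
  by apply: eq_bigr => x _; rewrite count_msub.
move=> x; rewrite mem_undup mem_cat -!has_pred1 !has_count count_msub; lia.
Qed.

Lemma dgr_half_perm z w : perm_eq z w -> dgr_half z w = 0.
Proof.
move=> zw; rewrite dgr_half_msub.
suff -> : msub z w = [::] by rewrite fsum_nil vdeg0.
apply/perm_nilP/perm_count => x.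
by rewrite count_msub /= (permP zw) subnn.
Qed.

Lemma dgr_perm z w : perm_eq z w -> dgr z w = 0.
Proof. by move=> zw; rewrite /dgr !dgr_half_perm // perm_sym. Qed.

Lemma dgr_half_cons x z w : dgr_half (x :: z) (x :: w) = dgr_half z w.
Proof.
rewrite !dgr_half_msub; congr vdeg; apply/fsum_perm/perm_count => y.
rewrite !count_msub /=; lia.
Qed.

Lemma dgr_cons x z w : dgr (x :: z) (x :: w) = dgr z w.
Proof. by rewrite /dgr !dgr_half_cons. Qed.

(** The common part [w] need not be the whole gcd: further cancellation between [u] and [u'] only
    lowers the degree. *)
Lemma dgr_half_cat z z' w u u' : perm_eq z (w ++ u) -> perm_eq z' (w ++ u') ->
  dgr_half z z' <= vdeg (fsum u).
Proof.
move=> zp zp'; rewrite dgr_half_msub.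
rewrite (fsum_perm (msub_split u u')) fsum_cat vdeg_add.
suff /fsum_perm -> : perm_eq (msub z z') (msub u u') by apply: leq_addl.
apply: perm_count => x; rewrite !count_msub (permP zp) (permP zp') !count_cat; lia.
Qed.

Lemma dgr_cat d z z' w u u' : perm_eq z (w ++ u) -> perm_eq z' (w ++ u') ->
  vdeg (fsum u) <= d -> vdeg (fsum u') <= d -> dgr z z' <= d.
Proof.
move=> zp zp' ud ud'; rewrite geq_max.
by rewrite (leq_trans (dgr_half_cat zp zp')) ?(leq_trans (dgr_half_cat zp' zp)).
Qed.

Definition vmove x (i i' : 'I_k) : vec k := vadd (vsub x (vunit i)) (vunit i').

(** The sum of truncated differences counts the units that [x] lacks compared with [y]. It is the
    measure for both exchange arguments, along fibres and between submultisets. *)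
Lemma vmove_closer x y i i' : x i < y i -> y i' < x i' ->
  \sum_j (y j - vmove x i' i j) < \sum_j (y j - x j).
Proof.
move=> lti lti'.
have ne : i != i' by apply: contraTneq lti => ->; rewrite -leqNgt ltnW.
rewrite (bigD1 i) //= [ltnRHS](bigD1 i) //= -addSn leq_add //.
  by rewrite /vmove !ffunE eqxx (negbTE ne); move: (x i) (y i) lti => *; lia.
apply: leq_sum => q /negbTE qi; rewrite /vmove !ffunE qi.
case: eqVneq => [->|_]; last by move: (x q) (y q) => *; lia.
by move: (x i') (y i') lti' => *; lia.
Qed.

End Vectors.

(** * Chains of factorizations *)

Section Chains.
Variables (G : zmodType) (k : nat) (h : 'I_k -> G).
Implicit Types (a b c x : vec k) (y z w u v : seq (vec k)).

Lemma inB_add a b : inB h a -> inB h (vadd a b) = inB h b.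
Proof.
rewrite /inB => /eqP Ea.
under eq_bigr => i _ do rewrite ffunE GRing.mulrnDr.
by rewrite big_split /= Ea GRing.add0r.
Qed.

Lemma inB_sub a b : vle a b -> inB h a -> inB h b -> inB h (vsub b a).
Proof. by move=> ab Ba; rewrite -{1}(vsubK ab) inB_add. Qed.

Lemma inB_fsum z : is_fact h z -> inB h (fsum z).
Proof.
elim: z => [|x z IH] zf.
  by rewrite fsum_nil /inB big1 // => i _; rewrite ffunE.
rewrite fsum_cons inB_add; last by case: (zf x (mem_head _ _)).
by apply: IH => y yz; apply: zf; rewrite inE yz orbT.
Qed.

Lemma is_fact_cons x z : is_fact h (x :: z) <-> is_atom h x /\ is_fact h z.
Proof.
split=> [H|[Hx Hz] y]; last by rewrite inE => /orP[/eqP -> | /Hz].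
split=> [|y yz]; apply: H; rewrite inE ?eqxx // yz orbT //.
Qed.

Lemma is_fact_cat z w : is_fact h (z ++ w) <-> is_fact h z /\ is_fact h w.
Proof.
split=> [H|[Hz Hw] y]; last by rewrite mem_cat => /orP[/Hz|/Hw].
by split=> y yz; apply: H; rewrite mem_cat yz ?orbT.
Qed.

Lemma is_fact_perm z w : perm_eq z w -> is_fact h z -> is_fact h w.
Proof. by move=> zw zf x; rewrite -(perm_mem zw); apply: zf. Qed.

Lemma atom_deg_gt0 x : is_atom h x -> 0 < vdeg x.
Proof. by case=> _ x0 _; rewrite lt0n vdeg_eq0. Qed.

Lemma exists_fact b : inB h b -> exists z, is_fact h z /\ fsum z = b.
Proof.
have [n] := ubnP (vdeg b); elim: n b => // n IH b lt Bb.
have [b0|b0] := eqVneq b (vzero k).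
  by exists [::]; split; [|rewrite fsum_nil].
have [|nat_] := decbP (is_atom h b).
  exists [:: b]; split; first by move=> x; rewrite inE => /eqP ->.
  by rewrite fsum_cons fsum_nil; apply/ffunP => i; rewrite !ffunE addn0.
have [[c [d [Bc Bd c0 d0 E]]]|ndec] := decbP
  (exists c d, [/\ inB h c, inB h d, c != vzero k, d != vzero k & b = vadd c d]).
  rewrite -!vdeg_eq0 in c0 d0; move: lt; rewrite E vdeg_add => lt.
  have [|z [zf zs]] := IH c _ Bc; first lia.
  have [|w [wf ws]] := IH d _ Bd; first lia.
  by exists (z ++ w); rewrite fsum_cat zs ws; split=> //; apply/is_fact_cat.
by case: nat_; split.
Qed.

Definition linked (d : nat) z z' : Prop :=
  exists ch : seq (seq (vec k)),
    [/\ forall y, y \in ch -> is_fact h y /\ fsum y = fsum z,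
        last z ch = z'
      & path (fun y w => dgr y w <= d) z ch].

Lemma linked_refl d z : linked d z z.
Proof. by exists [::]. Qed.

Lemma linked_step d z z' : is_fact h z' -> fsum z' = fsum z -> dgr z z' <= d ->
  linked d z z'.
Proof.
move=> zf zs le; exists [:: z']; split=> //=; last by rewrite le.
by move=> y; rewrite inE => /eqP ->.
Qed.

Lemma linked_weaken d d' z z' : d <= d' -> linked d z z' -> linked d' z z'.
Proof.
move=> dd' [s [Hs ls ps]]; exists s; split=> //.
by apply: sub_path ps => u v /leq_trans; apply.
Qed.

Lemma linked_fsum d z z' : linked d z z' -> fsum z' = fsum z.
Proof.
case=> ch [H <- _]; case: (lastP ch) H => [//|s x] H.
by rewrite last_rcons; case: (H x) => //; rewrite mem_rcons mem_head.
Qed.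

Lemma linked_trans d y z w : linked d z y -> linked d y w -> linked d z w.
Proof.
move=> zy; have E := linked_fsum zy; case: zy => s [Hs ls ps] [t [Ht lt pt]].
exists (s ++ t); split.
- move=> x; rewrite mem_cat => /orP[/Hs //|/Ht]; by rewrite E.
- by rewrite last_cat ls.
- by rewrite cat_path ps ls.
Qed.

Lemma linked_perm d z w : is_fact h z -> perm_eq z w -> linked d z w.
Proof.
move=> zf zw; apply: linked_step; last by rewrite dgr_perm.
  exact: is_fact_perm zf.
by rewrite (fsum_perm zw).
Qed.

Lemma linked_cons d x z w : is_atom h x -> linked d z w ->
  linked d (x :: z) (x :: w).
Proof.
move=> xa [s [Hs ls ps]]; exists (map (cons x) s); split.
- move=> _ /mapP[y ys ->]; have [yf yE] := Hs y ys.
  by rewrite !fsum_cons yE is_fact_cons.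
- by rewrite last_map ls.
- rewrite path_map; apply: sub_path ps => u v /=.
  by rewrite dgr_cons.
Qed.

Lemma linked_deg d z w : is_fact h w -> fsum w = fsum z -> vdeg (fsum z) <= d ->
  linked d z w.
Proof.
move=> wf E le; apply: linked_step => //.
by apply: (@dgr_cat _ _ _ _ [::] z w) => //; rewrite E.
Qed.

(* In degree [b], the catenary degree is controlled by the connectedness of the
   graph on the atoms below [b] in which [a] and [a'] are joined when
   [a + a' <= b]; [A] is a union of connected components. *)
Lemma cat_ok_of_connected d :
  (forall (A : pred (vec k)) z z',
     is_fact h z -> is_fact h z' -> fsum z = fsum z' -> d < vdeg (fsum z) ->
     all A z -> all (predC A) z' ->
     exists a (a' : vec k), [/\ is_atom h a, is_atom h a', A a, ~~ A a'
                    & vle (vadd a a') (fsum z)]) ->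
  cat_ok h d.
Proof.
move=> conn z z'; rewrite -/(linked d z z').
have [n] := ubnP (vdeg (fsum z)); elim: n z z' => // n IH z z' lt zf zf' E.
have [le|gt] := leqP (vdeg (fsum z)) d; first exact: linked_deg.
(* A shared atom is cancelled, which lowers the degree, and the induction hypothesis links the
   rests. *)
have common x w w' : is_fact h (x :: w) -> is_fact h (x :: w') ->
    fsum (x :: w) = fsum z -> fsum (x :: w') = fsum z ->
    linked d (x :: w) (x :: w').
  move=> /is_fact_cons[xa wf] /is_fact_cons[_ wf'] Ew Ew'.
  apply: linked_cons => //; apply: IH => //; last first.
    by apply: (@vadd_inj _ x); rewrite -!fsum_cons Ew Ew'.
  move: lt (atom_deg_gt0 xa); rewrite -Ew fsum_cons vdeg_add; lia.
have [//|nl] := decbP (linked d z z').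
(* [A] collects the atoms occurring in factorizations reachable from [z]. By [common], an atom of
   [z'] in [A] would make [z'] reachable. *)
pose A x := decb (exists w, [/\ is_fact h (x :: w) & linked d z (x :: w)]).
have [||a [a' [aa aa' /decbP[w [wf wl]] /decbP na' le]]] := conn A z z' zf zf' E gt.
- apply/allP => x xz; apply/decbP; exists (rem x z).
  have p := perm_to_rem xz.
  by split; [apply: is_fact_perm zf | apply: linked_perm].
- apply/allP => x xz; apply/decbP => -[w [wf wl]]; apply: nl.
  have p := perm_to_rem xz; have rf := is_fact_perm p zf'.
  have Ew := linked_fsum wl.
  apply: linked_trans wl _; apply: (@linked_trans _ (x :: rem x z')).
    by apply: common => //; rewrite E (fsum_perm p).
  by apply: linked_perm => //; rewrite perm_sym.
have Ba : inB h a by case: aa.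
have Ba' : inB h a' by case: aa'.
(* Completing [a + a'] to a factorization of the same element gives one that is reachable through
   [a] and contains [a'], so [a'] lies in [A] after all. *)
have [|u [uf us]] := @exists_fact (vsub (fsum z) (vadd a a')).
  apply: inB_sub => //; [by rewrite inB_add | exact: inB_fsum].
have Eu : fsum (a :: a' :: u) = fsum z by rewrite !fsum_cons us vaddA vsubK.
have auf : is_fact h (a :: a' :: u) by do !(apply/is_fact_cons; split=> //).
have p : perm_eq (a :: a' :: u) (a' :: a :: u).
  by apply/permP => q /=; rewrite addnCA.
case: na'; exists (a :: u); split; first exact: is_fact_perm auf.
have Ew := linked_fsum wl.
apply: linked_trans wl _; apply: (@linked_trans _ (a :: a' :: u)).
  by apply: common.
exact: linked_perm.
Qed.

Lemma c_gr_le d : cat_ok h d -> c_gr h <= d.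
Proof.
move=> ok; have okb : cat_okb h d by apply/decbP.
rewrite /c_gr; case: excluded_middle_informative => // H.
by case: ex_minnP => n _; apply.
Qed.

(** The hypothesis excludes the default value 0 of [c_gr]; in the theorem the rank bound supplies
    it. *)
Lemma cat_ok_c_gr d : cat_ok h d -> cat_ok h (c_gr h).
Proof.
move=> ok; have okb : cat_okb h d by apply/decbP.
rewrite /c_gr; case: excluded_middle_informative => [H|[]]; last by exists d.
by case: ex_minnP => n /decbP.
Qed.

(** The complement [vsub x y] lies in the monoid again, so a proper nonzero [y] would split [x]. *)
Lemma atom_minimal x (y : vec k) : is_atom h x -> inB h y -> y != vzero k -> vle y x -> y = x.
Proof.
move=> [Bx x0 nd] By y0 yx; apply: vle_deg_eq => //.
rewrite leqNgt; apply/negP => lt; apply: nd.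
exists y, (vsub x y); split=> //; rewrite ?inB_sub ?vsubK //.
rewrite -vdeg_eq0; move: lt; rewrite -{1}(vsubK yx) vdeg_add; lia.
Qed.

End Chains.

(** * Passing to the support *)

Lemma perm_map_lift (T1 T' : eqType) (f : T1 -> T')
    (z : seq T1) (y : seq T') :
  perm_eq (map f z) y -> exists2 z0, perm_eq z z0 & map f z0 = y.
Proof.
elim: y z => [|b y IH] z p.
  exists [::]; last by [].
  by move: (perm_size p); rewrite size_map /=; case: z {p}.
have : b \in map f z by rewrite (perm_mem p) mem_head.
case/mapP => a az E; have pz := perm_to_rem az.
have [|z0 pz0 E0] := IH (rem a z).
  move: p; rewrite (permPl (perm_map f pz)) /= -E perm_cons; exact.
exists (a :: z0); last by rewrite /= E0 E.
by rewrite (permPl pz) perm_cons.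
Qed.

Section Transfer.
Variables (G : zmodType) (m s : nat) (g : 'I_m -> G) (h : 'I_s -> G).
Variable phi : 'I_m -> 'I_s.
Hypothesis gE : forall i, g i = h (phi i).
Implicit Types (x y : vec m) (b c : vec s).

(** The transfer homomorphism to the monoid over the support: degrees and atoms are preserved, and
    factorizations lift. *)
Definition push x : vec s := [ffun j => \sum_(i | phi i == j) x i].

Lemma inB_push x : inB h (push x) = inB g x.
Proof.
rewrite /inB [in RHS](partition_big phi predT) //=; congr (_ == _).
apply: eq_bigr => j _; rewrite ffunE -GRing.sumrMnr.
by apply: eq_bigr => i /eqP ij; rewrite gE ij.
Qed.

Lemma vdeg_push x : vdeg (push x) = vdeg x.
Proof.
rewrite /vdeg [in RHS](partition_big phi predT) //=.
by apply: eq_bigr => j _; rewrite ffunE.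
Qed.

Lemma push_add x y : push (vadd x y) = vadd (push x) (push y).
Proof.
apply/ffunP => j; rewrite !ffunE -big_split /=.
by apply: eq_bigr => i _; rewrite ffunE.
Qed.

Lemma push_eq0 x : (push x == vzero s) = (x == vzero m).
Proof. by rewrite -!vdeg_eq0 vdeg_push. Qed.

Lemma push_unit i : push (vunit i) = vunit (phi i).
Proof.
apply/ffunP => j; rewrite !ffunE; case: eqVneq => [->|ne].
  rewrite (bigD1 i) //= ffunE eqxx big1 // => l /andP[_ /negbTE li].
  by rewrite ffunE li.
rewrite big1 // => l /eqP E; rewrite ffunE.
by case: eqVneq => // li; move: ne; rewrite -E li eqxx.
Qed.

Lemma push_fsum (z : seq (vec m)) : fsum (map push z) = push (fsum z).
Proof.
elim: z => [|x z IH] /=; last by rewrite !fsum_cons push_add IH.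
by rewrite !fsum_nil; apply/esym/eqP; rewrite push_eq0.
Qed.

(** Units of [b] are lifted one at a time: once [b] minus a unit at [j] is lifted to [y], the fibre
    of [j] still has room between [y] and [x]. *)
Lemma push_lift b x : vle b (push x) -> exists2 y, vle y x & push y = b.
Proof.
have [n] := ubnP (vdeg b); elim: n b => // n IH b lt bx.
have [b0|b0] := eqVneq b (vzero s).
  exists (vzero m); first by apply/vleP => i; rewrite ffunE.
  by rewrite b0; apply/eqP; rewrite push_eq0.
have [j bj] : exists j, 0 < b j.
  apply/existsP; apply: contraNT b0 => /existsPn H; apply/eqP/ffunP => j.
  by rewrite ffunE; apply/eqP; have := H j; rewrite lt0n negbK.
have uj : vle (vunit j) b.
  by apply/vleP => l; rewrite ffunE; case: eqVneq => // ->.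
have bE := vsubK uj.
have [||y yx yE] := IH (vsub b (vunit j)).
- by move: lt; rewrite -{1}bE vdeg_add vdeg_unit.
- apply: vle_trans bx; apply/vleP => l; rewrite ffunE; exact: leq_subr.
have [i /eqP ij yi] : exists2 i, phi i == j & y i < x i.
  apply/exists_inP; apply: contraLR bx => /exists_inPn H.
  apply/negP => /vleP/(_ j).
  suff le : push x j <= push y j.
    by move/leq_trans/(_ le); rewrite yE !ffunE eqxx; move: bj; lia.
  by rewrite !ffunE; apply: leq_sum => i /H; rewrite -leqNgt.
exists (vadd (vunit i) y); last by rewrite push_add push_unit ij yE.
apply/vleP => l; rewrite !ffunE; case: eqVneq => [->//|_].
by rewrite add0n; apply: (vleP _ _ yx).
Qed.

(** Decompositions push forward, and lift back by [push_lift]; summands stay nonzero because degrees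
    are preserved. *)
Lemma atom_push x : is_atom h (push x) <-> is_atom g x.
Proof.
split=> -[Bx x0 nd]; split; rewrite -?inB_push -?push_eq0 //; move: Bx x0;
  rewrite ?inB_push ?push_eq0 // => Bx x0 [b [c [Bb Bc b0 c0 E]]]; apply: nd.
  by exists (push b), (push c); rewrite !inB_push !push_eq0 -push_add -E; split.
have [|y yx yE] := @push_lift b x; first by rewrite E vle_addr.
have cE : push (vsub x y) = c.
  by apply: (@vadd_inj _ b); rewrite -E -{1}yE -push_add vsubK.
exists y, (vsub x y); split; rewrite -?inB_push -?push_eq0 ?yE ?cE ?vsubK //.
Qed.

Lemma fact_push z : is_fact h (map push z) <-> is_fact g z.
Proof.
split=> [H x xz|H _ /mapP[x xz ->]]; apply/atom_push; last exact: H.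
by apply: H; rewrite map_f.
Qed.

Lemma fsum_lift (y : seq (vec s)) x : fsum y = push x ->
  exists2 z, map push z = y & fsum z = x.
Proof.
elim: y x => [|b y IH] x E.
  exists [::] => //; apply/esym/eqP.
  by rewrite fsum_nil -push_eq0 -E fsum_nil.
have [|t tx tE] := @push_lift b x; first by rewrite -E fsum_cons vle_addr.
have [|z zE zs] := IH (vsub x t).
  by apply: (@vadd_inj _ b); rewrite -fsum_cons E -{1}tE -push_add vsubK.
by exists (t :: z); rewrite /= ?zE ?tE // fsum_cons zs vsubK.
Qed.

(** The atoms of [z] over the gcd of [map push z] and [y] are kept. The others are replaced by a
    lift, with the same sum, of the rest of [y]; the distance does not grow because [push] preserves
    degrees. *)
Lemma step_lift d (z : seq (vec m)) (y : seq (vec s)) :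
  is_fact g z -> is_fact h y -> fsum y = fsum (map push z) ->
  dgr (map push z) y <= d ->
  exists z', [/\ linked g d z z', is_fact g z' & map push z' = y].
Proof.
move=> zf yf E le; set u := msub (map push z) y; set v := msub y (map push z).
set w := msub (map push z) u.
have pz : perm_eq (map push z) (w ++ u) := msub_split _ _.
have py : perm_eq y (w ++ v).
  by rewrite (permPl (msub_split y (map push z))) perm_cat2r msub_common.
have [z0 zz0 z0E] := perm_map_lift pz.
move: le; rewrite /dgr !dgr_half_msub geq_max -/u -/v => /andP[ud vd].
have [z1 [z2 [z1E z2E z0E']]] :
    exists z1 z2, [/\ map push z1 = w, map push z2 = u & z0 = z1 ++ z2].
  exists (take (size w) z0), (drop (size w) z0).
  by rewrite map_take map_drop z0E take_size_cat // drop_size_cat // cat_take_drop.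
have [|z3 z3E z32] := @fsum_lift v (fsum z2).
  rewrite -push_fsum z2E; apply: (@vadd_inj _ (fsum w)).
  by rewrite -!fsum_cat -(fsum_perm pz) -(fsum_perm py).
have pE : perm_eq (map push (z1 ++ z3)) y by rewrite map_cat z1E z3E perm_sym.
have z'f : is_fact g (z1 ++ z3).
  by apply/fact_push; apply: is_fact_perm yf; rewrite perm_sym.
(* Reordering makes the image equal to [y] as a sequence, so that the next step of a chain can start
   from it. *)
have [z' zz' z'E] := perm_map_lift pE.
have z'f' := is_fact_perm zz' z'f.
rewrite z0E' in zz0; exists z'; split=> //.
apply: linked_trans (linked_perm _ z'f zz').
apply: linked_step => //; first by rewrite (fsum_perm zz0) !fsum_cat z32.
by apply: (dgr_cat zz0) => //; rewrite ?z32 -vdeg_push -push_fsum z2E // -z32 -push_fsum z3E.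
Qed.

Lemma chain_lift d (z : seq (vec m)) (y : seq (vec s)) :
  is_fact g z -> linked h d (map push z) y ->
  exists z', [/\ linked g d z z', is_fact g z' & map push z' = y].
Proof.
move=> zf [ch]; elim: ch z zf => [|w ch IH] z zf [Hs ls /= ps].
  by exists z; rewrite -ls; split=> //; apply: linked_refl.
have [le ps'] := andP ps; have [wf ws] := Hs w (mem_head _ _).
have [z1 [l1 z1f E1]] := step_lift zf wf ws le.
have [|z2 [l2 z2f E2]] := IH z1 z1f.
  rewrite E1; split=> // t tch; rewrite ws; apply: Hs; by rewrite inE tch orbT.
by exists z2; split=> //; apply: linked_trans l2.
Qed.

Lemma push_move x i i' : phi i = phi i' -> 0 < x i -> push (vmove x i i') = push x.
Proof.
move=> ii' xi; have ux : vle (vunit i) x.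
  by apply/vleP => l; rewrite ffunE; case: eqVneq => [->|].
rewrite push_add push_unit -ii' -push_unit -push_add vaddC; congr push.
exact: vsubK.
Qed.

(** The two vectors have equal sums over each fibre, so a deficit at one index is balanced by a
    surplus at another index of its fibre. *)
Lemma push_neq x y : push x = push y -> x != y ->
  exists i i', [/\ phi i = phi i', x i < y i & y i' < x i'].
Proof.
move=> E ne; suff wlog x' y' : push x' = push y' -> (exists i, x' i < y' i) ->
    exists i i', [/\ phi i = phi i', x' i < y' i & y' i' < x' i'].
  have [i] : exists i, x i != y i.
    apply/existsP; apply: contraNT ne => /existsPn H; apply/eqP/ffunP => i.
    by have := H i; rewrite negbK => /eqP.
  rewrite neq_ltn => /orP[lt|lt]; first by apply: wlog => //; exists i.
  have [||j [j' [jj' l1 l2]]] := wlog y x; rewrite ?E //; first by exists i.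
  by exists j', j.
move=> {x y ne}E [i lt].
have [i' /eqP ii' lt'] : exists2 i', phi i' == phi i & y' i' < x' i'.
  apply/exists_inP; apply: contraT => /exists_inPn H.
  have := congr1 (fun v : vec s => v (phi i)) E; rewrite !ffunE.
  rewrite (bigD1 i) //= [in RHS](bigD1 i) //=.
  have : \sum_(j | (phi j == phi i) && (j != i)) x' j <=
         \sum_(j | (phi j == phi i) && (j != i)) y' j.
    by apply: leq_sum => j /andP[/H]; rewrite -leqNgt.
  by move=> le eq; have := leq_add lt le; rewrite -[leqRHS]eq addSn ltnn.
by exists i, i'.
Qed.

(* Exchanging a unit between two atoms along a fibre of [phi] does not change
   their images, so they stay atoms. *)
Lemma fibre_linked M (z z' : seq (vec m)) :
  (forall x, is_atom g x -> vdeg x <= M) ->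
  is_fact g z -> is_fact g z' -> fsum z = fsum z' -> map push z = map push z' ->
  linked g (2 * M) z z'.
Proof.
(* The outer induction is on the number of atoms, the inner one on the units that the head of [z]
   lacks compared with the head of [z']. *)
move=> HM; have [l] := ubnP (size z); elim: l z z' => // l IH [|x z] [|y w] //.
  by move=> *; apply: linked_refl.
move=> lz; have [n] := ubnP (\sum_i (y i - x i)); elim: n x z lz => // n IHn x z lz lt.
move=> /is_fact_cons[xa zf] /is_fact_cons[ya wf] Es [Exy Em].
have [exy|nxy] := eqVneq x y.
  move: Es; rewrite exy !fsum_cons => /vadd_inj Es.
  by apply: linked_cons => //; apply: IH.
have [i [i' [ii' lti lti']]] := push_neq Exy nxy.
(* The total at [i] is the same on both sides, so the unit missing in the head [x] is found in
   another atom [t], which receives a unit at [i'] in return. *)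
have [t tz ti] : exists2 t, t \in z & 0 < t i.
  apply/hasP; apply: contraT => /hasPn H.
  have := congr1 (fun v : vec m => v i) Es; rewrite !fsum_cons !ffunE.
  rewrite big1_seq; first lia.
  by move=> t /andP[_ /H]; rewrite -eqn0Ngt => /eqP.
case/splitPr: tz zf Em Es lz => z1 z2 zf Em Es lz.
have [z1f /is_fact_cons[ta z2f]] := (is_fact_cat g z1 (t :: z2)).1 zf.
pose x1 := vmove x i' i; pose t1 := vmove t i i'.
have Px : push x1 = push x by apply: push_move; [rewrite ii' | lia].
have Pt : push t1 = push t by apply: push_move.
have x1a : is_atom g x1 by apply/atom_push; rewrite Px; apply/atom_push.
have t1a : is_atom g t1 by apply/atom_push; rewrite Pt; apply/atom_push.
have z1f' : is_fact g (z1 ++ t1 :: z2) by apply/is_fact_cat; split=> //; apply/is_fact_cons.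
have Es1 : fsum (x1 :: z1 ++ t1 :: z2) = fsum (x :: z1 ++ t :: z2).
  have ne : i != i' by apply/eqP => E; move: lti lti'; rewrite E; lia.
  apply/ffunP => q; rewrite !(fsum_cons, fsum_cat) /x1 /t1 /vmove !ffunE.
  move: ti lti'; case: (eqVneq q i) => [->|_].
    by rewrite (negbTE ne) /=; move: (t i) (x i) (x i') => *; lia.
  case: (eqVneq q i') => [->|_] /=; first by move: (t i') (x i') => *; lia.
  by move: (t q) (x q) => *; lia.
apply: (@linked_trans _ _ _ _ (x1 :: z1 ++ t1 :: z2)).
  apply: linked_step => //; first exact/is_fact_cons.
  have p (a b : vec m) : perm_eq (a :: z1 ++ b :: z2) ((z1 ++ z2) ++ [:: a; b]).
    apply/permP => q; rewrite /= !count_cat /=; lia.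
  have V2 (a b : vec m) : vdeg (fsum [:: a; b]) = vdeg a + vdeg b.
    by rewrite vdeg_fsum !big_cons big_nil addn0.
  by apply: (dgr_cat (p x t) (p x1 t1)); rewrite V2 mul2n -addnn;
    apply: leq_add; apply: HM.
apply: IHn => //; try exact/is_fact_cons; last 2 first.
- by rewrite Es1.
- by rewrite /= map_cat /= Px Pt Exy -Em map_cat.
- by move: lz; rewrite /= !size_cat.
apply: leq_trans _ (lt : _ <= n).
exact: vmove_closer.
Qed.

Lemma cat_ok_transfer M d : (forall x, is_atom g x -> vdeg x <= M) ->
  cat_ok h d -> cat_ok g (maxn (2 * M) d).
Proof.
move=> HM ok z z' zf zf' E.
have Ep : fsum (map push z) = fsum (map push z') by rewrite !push_fsum E.
have [z1 [l1 z1f E1]] := chain_lift zf (ok _ _ ((fact_push z).2 zf) ((fact_push z').2 zf') Ep).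
have l2 := fibre_linked HM z1f zf' (etrans (linked_fsum l1) E) E1.
apply: linked_trans (linked_weaken (leq_maxr _ _) l1) (linked_weaken (leq_maxl _ _) l2).
Qed.

End Transfer.

(** * The Davenport bound *)

Lemma vle_interpolate k (x b : vec k) n : vle x b -> vdeg x <= n <= vdeg b ->
  exists M, [/\ vle x M, vle M b & vdeg M = n].
Proof.
move=> xb; elim: n => [|n IH] /andP[xn nb].
  by exists x; split=> //; [apply/vleP | apply/eqP; rewrite -leqn0].
move: xn; rewrite leq_eqVlt => /orP[/eqP xn|xn].
  by exists x; split=> //; apply/vleP.
have [|M [xM Mb Mn]] := IH; first by rewrite -ltnS xn ltnW.
have /forallPn[i] : ~~ vle b M.
  by apply/negP => /vdeg_le; rewrite Mn leqNgt nb.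
rewrite -ltnNge => Mi; exists (vadd M (vunit i)).
split; last by rewrite vdeg_add vdeg_unit Mn addn1.
  by apply: vle_trans xM _; apply: vle_addr.
apply/vleP => j; rewrite !ffunE; case: eqVneq => [->|_]; first by rewrite addn1.
by rewrite addn0; apply/vleP.
Qed.

Section Davenport.
Variables (G : zmodType) (k : nat) (h : 'I_k -> G) (D : nat).
Hypothesis dav : is_davenport h D.

(** By minimality of atoms, an atom with one unit removed has no atom below it, so what remains has
    degree at most [D]. *)
Lemma davenport_atom_deg x : is_atom h x -> vdeg x <= D.+1.
Proof.
move=> xa; have /existsP[i xi] : [exists i, 0 < x i].
  apply: contraT => /existsPn H; have := atom_deg_gt0 xa.
  by rewrite lt0n vdeg_eq0 => /eqP[]; apply/ffunP => i; rewrite ffunE;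
    apply/eqP; have := H i; rewrite lt0n negbK.
have ux : vle (vunit i) x by apply/vleP => j; rewrite ffunE; case: eqVneq => [->|].
rewrite -(vsubK ux) vdeg_add vdeg_unit add1n ltnS; apply: dav.2 => c ca.
apply/existsP; apply: contraT => /existsPn H.
have cx : vle c (vsub x (vunit i)) by apply/vleP => j; rewrite leqNgt.
have cx' : vle c x by apply: vle_trans cx _; apply/vleP => j; rewrite ffunE leq_subr.
have [Bc c0 _] := ca; have E := atom_minimal xa Bc c0 cx'.
by move/vleP/(_ i): cx; rewrite E !ffunE eqxx; lia.
Qed.

Lemma davenport_has_atom b : D < vdeg b -> exists2 c, is_atom h c & vle c b.
Proof.
move=> lt; have [[c [ca cb]]|no] := decbP (exists c, is_atom h c /\ vle c b).
  by exists c.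
have /(dav.2 b) : dav_ok h b; last by rewrite leqNgt lt.
move=> c ca; apply/existsP; apply: contraT => /existsPn H; case: no.
by exists c; split=> //; apply/vleP => i; rewrite leqNgt.
Qed.

(* Connectedness of the Kneser graph of the [(D+1)]-element submultisets of a
   multiset [b] of size at least [2D+3]: every such submultiset contains an atom,
   two of them differing by one exchange miss a common third one. *)
Lemma cat_ok_davenport : cat_ok h (2 * D + 2).
Proof.
apply: cat_ok_of_connected => A z z' zf zf' E; move Eb: (fsum z) => b big Az Az'.
apply: NNPP => no.
(* Atoms inside disjoint submultisets of [b] are joined, so [A] cannot tell them apart. *)
have same M N c e : vle (vadd M N) b -> is_atom h c -> is_atom h e ->
    vle c M -> vle e N -> A c = A e.
  move=> MN ca ea /vleP cM /vleP eN.
  have le (c' e' : vec k) : (forall i, c' i + e' i <= M i + N i) -> vle (vadd c' e') b.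
    move=> H; apply: vle_trans MN; apply/vleP => i; rewrite !ffunE; exact: H.
  apply/idP/idP => Ax; apply: contraT => nA; case: no.
    by exists c, e; split=> //; apply: le => i; rewrite leq_add.
  by exists e, c; split=> //; apply: le => i; rewrite addnC leq_add.
(* [M] is transformed into [M'] by exchanging one unit at a time. *)
have move_ M M' c c' : vle M b -> vle M' b -> vdeg M = D.+1 -> vdeg M' = D.+1 ->
    is_atom h c -> is_atom h c' -> vle c M -> vle c' M' -> A c = A c'.
  have [n] := ubnP (\sum_i (M' i - M i)); elim: n M c => // n IH M c lt.
  move=> Mb M'b dM dM' ca ca' cM cM'.
  have [EM|neM] := eqVneq M M'.
    have [|e ea eN] := @davenport_has_atom (vsub b M).
      by move: big; rewrite -{1}(vsubK Mb) vdeg_add dM; lia.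
    have MN : vle (vadd M (vsub b M)) b by rewrite vsubK //; apply/vleP.
    by rewrite (same _ _ _ _ MN ca ea) // (same _ _ _ _ MN ca' ea) // EM.
  have /forallPn[i] : ~~ vle M' M.
    by apply: contra neM => le; rewrite (vle_deg_eq le) ?dM ?dM'.
  have /forallPn[i'] : ~~ vle M M'.
    by apply: contra neM => le; rewrite (vle_deg_eq le) ?dM ?dM'.
  rewrite -!ltnNge => lti' lti.
  (* [M] and its exchange both lie in [M] plus a unit at [i], of degree [D + 2]. Its complement in
     [b] has degree at least [D + 1], hence contains an atom joined to those of both; this is where
     [2 * D + 3] comes from. *)
  have Wb : vle (vadd M (vunit i)) b.
    apply/vleP => j; rewrite !ffunE; case: eqVneq => [->|_].
      by rewrite addn1; apply: leq_trans lti (vleP _ _ M'b i).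
    by rewrite addn0; apply: (vleP _ _ Mb j).
  have [|e ea eN] := @davenport_has_atom (vsub b (vadd M (vunit i))).
    by move: big; rewrite -{1}(vsubK Wb) !vdeg_add dM vdeg_unit; lia.
  have ui' : vle (vunit i') M.
    by apply/vleP => j; rewrite ffunE; case: eqVneq => [->|_] //; lia.
  have dM1 : vdeg (vmove M i' i) = D.+1.
    by rewrite -dM -{2}(vsubK ui') !vdeg_add !vdeg_unit addnC.
  have M1W : vle (vmove M i' i) (vadd M (vunit i)).
    by apply/vleP => j; rewrite !ffunE leq_add2r leq_subr.
  have [|c1 c1a c1M] := @davenport_has_atom (vmove M i' i); first by rewrite dM1.
  have sub V : vle V (vadd M (vunit i)) ->
      vle (vadd V (vsub b (vadd M (vunit i)))) b.
    move=> /vleP VW; rewrite -{2}(vsubK Wb).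
    by apply/vleP => j; rewrite [_ j]ffunE [leqRHS]ffunE leq_add2r.
  rewrite (same _ _ _ _ (sub M (vle_addr _ _)) ca ea cM eN).
  rewrite -(same _ _ _ _ (sub _ M1W) c1a ea c1M eN).
  apply: (IH (vmove M i' i)) => //; last exact: vle_trans Wb.
  apply: leq_trans _ (lt : _ <= n).
  exact: vmove_closer.
have nonempty (w : seq (vec k)) : fsum w = b -> exists x, x \in w.
  case: w => [Ew|x w _]; last by exists x; rewrite mem_head.
  by move: big; rewrite -Ew fsum_nil vdeg0.
have [x xz] := nonempty z Eb.
have [y yz] := nonempty z' (etrans (esym E) Eb).
have ext t : t \in z \/ t \in z' ->
    is_atom h t /\ exists M, [/\ vle t M, vle M b & vdeg M = D.+1].
  move=> tz; have ta : is_atom h t by case: tz => [/zf|/zf'].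
  split=> //; apply: vle_interpolate; last by rewrite davenport_atom_deg //=; lia.
  by rewrite -Eb; case: tz; [|rewrite E]; apply: vle_fsum.
have [xa [M [xM Mb dM]]] := ext x (or_introl xz).
have [ya [M' [yM' M'b dM']]] := ext y (or_intror yz).
have := move_ _ _ _ _ Mb M'b dM dM' xa ya xM yM'.
by rewrite (allP Az) //; have := allP Az' _ yz; rewrite /= => /negbTE ->.
Qed.

End Davenport.

Import Order.TTheory GRing.Theory Num.Theory.

(** * Walking along the edges of a polytope *)

Section Polytope.
Local Open Scope ring_scope.
Variable F : realFieldType.

(** The longest admissible step along [- e] is the least ratio [x 0 i / e 0 i] over the constrained
    coordinates with [e 0 i > 0], and a minimizing coordinate reaches zero. *)
Lemma ratio_test n (Q : pred 'I_n) (x e : 'rV[F]_n) :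
  (forall i, Q i -> 0 <= x 0 i) -> (exists2 i, Q i & 0 < e 0 i) ->
  exists t i1, [/\ 0 <= t, Q i1, 0 < e 0 i1, x 0 i1 = t * e 0 i1
                 & forall i, Q i -> 0 <= x 0 i - t * e 0 i].
Proof.
move=> x0 [i0 Qi0 ei0]; pose R := [pred i | Q i && (0 < e 0 i)].
have Ri0 : R i0 by rewrite /= Qi0.
pose i1 := [arg min_(i < i0 | R i) (x 0 i / e 0 i)]%O.
have [/andP[Qi1 ei1] le] : R i1 /\ forall i, R i -> x 0 i1 / e 0 i1 <= x 0 i / e 0 i.
  by rewrite /i1; case: arg_minP.
have t0 : 0 <= x 0 i1 / e 0 i1 by rewrite divr_ge0 ?x0 // ltW.
exists (x 0 i1 / e 0 i1), i1; split=> //; first by rewrite divfK // gt_eqF.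
move=> i Qi; rewrite subr_ge0; have [ei|ei] := ltP 0 (e 0 i).
  by rewrite -ler_pdivlMr // le //= Qi.
by apply: le_trans (x0 i Qi); rewrite mulr_ge0_le0.
Qed.

(* Otherwise let [L i] label the coordinates at least [1] at time [0]; between the
   last time [leave k] at which one of them is at least [1] and the first time
   [enter l] at which one of the other label is, no coordinate is at least [1]. *)
Lemma segment_label n (L : pred 'I_n) (x y : 'rV[F]_n) :
  (forall t, 0 <= t <= 1 -> exists i, 1 <= x 0 i + t * (y 0 i - x 0 i)) ->
  (forall t, 0 <= t <= 1 -> forall i j, 1 <= x 0 i + t * (y 0 i - x 0 i) ->
     1 <= x 0 j + t * (y 0 j - x 0 j) -> L i = L j) ->
  forall i j, 1 <= x 0 i -> 1 <= y 0 j -> L i = L j.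
Proof.
move=> cover sep i0 j0 xi yj; apply/eqP; apply: contraT => Lij.
have sep0 i j : 1 <= x 0 i -> 1 <= x 0 j -> L i = L j.
  by move=> xi1 xj1; apply: (sep 0); rewrite ?mul0r ?addr0 // lexx ler01.
have sep1 i j : 1 <= y 0 i -> 1 <= y 0 j -> L i = L j.
  by move=> yi1 yj1; apply: (sep 1); rewrite ?mul1r ?subrKC // lexx ler01.
pose K := [pred i | (L i == L i0) && (1 <= x 0 i)].
pose J := [pred i | (L i != L i0) && (1 <= y 0 i)].
have KP i : K i -> y 0 i < 1.
  by case/andP=> /eqP Li _; rewrite ltNge; apply: contra Lij => yi; rewrite -Li; apply/eqP/sep1.
have JP i : J i -> x 0 i < 1.
  by case/andP=> Li _; rewrite ltNge; apply: contra Li => xi1; apply/eqP/sep0.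
(* Coordinates outside [K] and [J] are below 1 at both ends, hence on the whole segment. *)
have nK i : L i == L i0 -> ~~ K i -> x 0 i < 1 /\ y 0 i < 1.
  move=> Li; rewrite /= Li /= -ltNge; split=> //; rewrite ltNge.
  by apply: contra Lij => yi; rewrite -(eqP Li); apply/eqP/sep1.
have nJ i : L i != L i0 -> ~~ J i -> x 0 i < 1 /\ y 0 i < 1.
  move=> Li; rewrite /= Li /= -ltNge; split=> //; rewrite ltNge.
  by apply: contra Li => xi1; apply/eqP/sep0.
pose leave i := (x 0 i - 1) / (x 0 i - y 0 i).
pose enter i := (1 - x 0 i) / (y 0 i - x 0 i).
have Ki0 : K i0 by rewrite /= eqxx.
have Jj0 : J j0 by rewrite /= eq_sym Lij.
have [k Kk kmax] : exists2 k, K k & forall i, K i -> leave i <= leave k.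
  by case: (arg_maxP (P := K) leave Ki0) => k Kk H; exists k.
have [l Jl lmin] : exists2 l, J l & forall i, J i -> enter l <= enter i.
  by case: (arg_minP (P := J) enter Jj0) => l Jl H; exists l.
have leaveE i : K i -> leave i * (x 0 i - y 0 i) = x 0 i - 1.
  by move=> Ki; rewrite divfK // subr_eq0 gt_eqF // (lt_le_trans (KP _ Ki)) //; case/andP: Ki.
have enterE i : J i -> enter i * (y 0 i - x 0 i) = 1 - x 0 i.
  by move=> Ji; rewrite divfK // subr_eq0 gt_eqF // (lt_le_trans (JP _ Ji)) //; case/andP: Ji.
have [k1 k2] := (KP _ Kk, proj2 (andP Kk)).
have [l1 l2] := (JP _ Jl, proj2 (andP Jl)).
have Ek := leaveE _ Kk; have El := enterE _ Jl.
have lk0 : 0 <= leave k by rewrite divr_ge0 ?subr_ge0 // (le_trans (ltW k1)).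
have el0 : 0 <= enter l by rewrite divr_ge0 ?subr_ge0 ?(ltW l1) // (le_trans (ltW l1)).
have lk1 : leave k < 1 by nra.
have el1 : enter l <= 1 by nra.
(* Otherwise both [k] and [l] are at least 1 at time [enter l], though their labels differ. *)
have lt : leave k < enter l.
  rewrite ltNge; apply/negP => le.
  have Llk : L k = L l by apply: (sep (enter l)); nra.
  by case/andP: Jl => /negP[]; rewrite -Llk; case/andP: Kk.
pose t := (leave k + enter l) / 2.
have [tk tl] : leave k < t /\ t < enter l by rewrite /t; split; lra.
have t01 : 0 <= t <= 1 by apply/andP; split; lra.
have [i] := cover t t01; rewrite leNgt => /negP[].
have [Li|Li] := boolP (L i == L i0).
  have [Ki|Ki] := boolP (K i); last by have [] := nK _ Li Ki; nra.
  by have := kmax _ Ki; have := leaveE _ Ki; have := KP _ Ki; case/andP: Ki; nra.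
have [Ji|Ji] := boolP (J i); last by have [] := nJ _ Li Ji; nra.
by have := lmin _ Ji; have := enterE _ Ji; have := JP _ Ji; case/andP: Ji; nra.
Qed.

(** * Vertices and edge directions *)

Section BasicPoints.
Variables (n k : nat) (A : 'M[F]_(n, k)) (b : 'rV[F]_k).
Implicit Types (x y e d : 'rV[F]_n) (S T : {set 'I_n}).

Definition rsupp x : {set 'I_n} := [set i | x 0 i != 0].
Definition feasible x : Prop := x *m A = b /\ forall i, 0 <= x 0 i.
(** A feasible [x] is a vertex of the polytope exactly when this holds for [rsupp x]. *)
Definition rows_indep S : Prop :=
  forall e, e *m A = 0 -> rsupp e \subset S -> e = 0.
(** The feasible points supported on [S] then lie on a line: they form a face of dimension at most
    one. *)
Definition rows_thin S : Prop :=
  exists d, forall e, e *m A = 0 -> rsupp e \subset S -> exists c, e = c *: d.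

Lemma rsuppP x S : reflect (forall i, i \notin S -> x 0 i = 0) (rsupp x \subset S).
Proof.
apply: (iffP subsetP) => H i.
  by apply: contraNeq => xi; apply: H; rewrite inE.
by rewrite inE; apply: contraNT => /H ->.
Qed.

Lemma rsupp_notin x i : i \notin rsupp x -> x 0 i = 0.
Proof. by rewrite inE negbK => /eqP. Qed.

Lemma rsuppN x : rsupp (- x) = rsupp x.
Proof. by apply/setP => i; rewrite !inE mxE oppr_eq0. Qed.

(** While the support carries a nonzero relation, moving along it until a coordinate vanishes
    shrinks the support. *)
Lemma exists_basic x : feasible x ->
  exists y, [/\ feasible y, rows_indep (rsupp y) & rsupp y \subset rsupp x].
Proof.
have [l] := ubnP #|rsupp x|; elim: l x => // l IH x lt [xA x0].
have [ind|dep] := decbP (rows_indep (rsupp x)); first by exists x.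
have [e [eA ex [i0 ei0]]] :
    exists e, [/\ e *m A = 0, rsupp e \subset rsupp x & exists i, 0 < e 0 i].
  have [e [eA ex /eqP/rV0Pn[i ei]]] :
      exists e, [/\ e *m A = 0, rsupp e \subset rsupp x & e <> 0].
    apply: NNPP => no; apply: dep => e eA ex; apply: NNPP => ne.
    by apply: no; exists e.
  have [ei'|ei'] := ltP 0 (e 0 i); first by exists e; split=> //; exists i.
  exists (- e); rewrite mulNmx eA oppr0 rsuppN; split=> //; exists i.
  by rewrite mxE oppr_gt0 lt_neqAle ei.
have [|t [i1 [_ _ ei1 xi1 pos]]] := @ratio_test n predT x e (fun i _ => x0 i).
  by exists i0.
have sub : rsupp (x - t *: e) \subset rsupp x.
  apply/rsuppP => i /[dup] /rsupp_notin xi /(rsuppP _ _ ex) ei.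
  by rewrite !mxE xi ei mulr0 subrr.
have prop : rsupp (x - t *: e) \proper rsupp x.
  apply/properP; split=> //; exists i1.
    by apply: (subsetP ex); rewrite inE gt_eqF.
  by rewrite inE !mxE xi1 subrr eqxx.
have [||y [fy iy yx]] := IH (x - t *: e).
- by apply: leq_trans (proper_card prop) _.
- split; first by rewrite mulmxBl -scalemxAl eA scaler0 subr0.
  by move=> i; rewrite !mxE pos.
by exists y; split=> //; apply: subset_trans sub.
Qed.

Lemma rows_indep_thin S : rows_indep S -> rows_thin S.
Proof. by move=> ind; exists 0 => e eA eS; exists 0; rewrite (ind e eA eS) scale0r. Qed.

(** The objective of the simplex method: if [T] is the support of a vertex [y], it is nonnegative on
    the polytope and vanishes only at [y]. *)
Definition cost T x : F := \sum_(i | i \notin T) x 0 i.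

Lemma costB T x t e : cost T (x - t *: e) = cost T x - t * cost T e.
Proof.
rewrite /cost mulr_sumr -sumrB; apply: eq_bigr => i _.
by rewrite !mxE.
Qed.

Lemma costN T x : cost T (- x) = - cost T x.
Proof. by rewrite /cost -sumrN; apply: eq_bigr => i _; rewrite mxE. Qed.

(* A descent direction at a basic point supported on [S]; taking one with
   smallest support outside [S] makes it an edge direction. *)
Lemma edge_direction S T d :
  rows_indep S -> d *m A = 0 -> (forall i, i \notin S -> 0 <= d 0 i) -> cost T d < 0 ->
  exists d', [/\ d' *m A = 0, forall i, i \notin S -> 0 <= d' 0 i, cost T d' < 0
               & rows_thin (S :|: rsupp d')].
Proof.
move=> indS; have [l] := ubnP #|rsupp d :\: S|; elim: l d => // l IH d lt dA d0 dc.
have [th|nth_] := decbP (rows_thin (S :|: rsupp d)); first by exists d.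
have [e0 [e0A e0S ne0]] : exists e, [/\ e *m A = 0, rsupp e \subset S :|: rsupp d
    & forall c, e <> c *: d].
  apply: NNPP => no; apply: nth_; exists d => e eA eS; apply: NNPP => ne.
  by apply: no; exists e; split=> // c E; apply: ne; exists c.
have [e [eA eS ec [i0 i0S ei0]]] : exists e, [/\ e *m A = 0,
    rsupp e \subset S :|: rsupp d, cost T e = 0 & exists2 i, i \notin S & 0 < e 0 i].
  (* This multiple of [d] makes the cost of [e] zero. If [e] were supported on [S], independence
     would give [e = 0], and [e0] would be a multiple of [d]. *)
  pose e := e0 - (cost T e0 / cost T d) *: d.
  have eA : e *m A = 0 by rewrite mulmxBl -scalemxAl e0A dA scaler0 subrr.
  have eS : rsupp e \subset S :|: rsupp d.
    apply/rsuppP => i /[dup] /(rsuppP _ _ e0S); rewrite !mxE => ->.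
    by rewrite inE negb_or => /andP[_ /rsupp_notin ->]; rewrite mulr0 subrr.
  have ec : cost T e = 0 by rewrite costB divfK ?subrr // lt_eqF.
  have [i iS ei] : exists2 i, i \notin S & e 0 i != 0.
    apply: NNPP => no; apply: (ne0 (cost T e0 / cost T d)); apply/eqP.
    rewrite -subr_eq0; apply/eqP/indS => //; apply/rsuppP => i iS.
    by apply: contra_not_eq no => ei; exists i.
  have [ei'|ei'] := ltP 0 (e 0 i); first by exists e; split=> //; exists i.
  exists (- e); rewrite mulNmx eA oppr0 rsuppN; split=> //.
    by rewrite costN ec oppr0.
  by exists i; rewrite // mxE oppr_gt0 lt_neqAle ei.
(* Subtracting [t *: e] from [d] keeps the cost and the signs outside [S], and removes [i1] from the
   support. *)
have [|t [i1 [_ i1S ei1 di1 pos]]] := @ratio_test n [pred i | i \notin S] d e d0.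
  by exists i0.
rewrite /= in i1S; have i1d : i1 \in rsupp d.
  by have := subsetP eS i1; rewrite !inE (negbTE i1S) /= gt_eqF // => ->.
apply: (IH (d - t *: e)).
- apply: leq_trans (_ : #|rsupp d :\: S| <= l)%N => //; apply: proper_card.
  apply/properP; split; last first.
    by exists i1; rewrite in_setD i1S // inE !mxE di1 subrr eqxx.
  apply/subsetP => i; rewrite !in_setD => /andP[iS]; rewrite iS /=.
  rewrite !inE; apply: contraNneq => di.
  have ei : e 0 i = 0.
    by apply: (rsuppP _ _ eS); rewrite inE negb_or iS inE di eqxx.
  by rewrite !mxE di ei mulr0 subrr.
- by rewrite mulmxBl -scalemxAl dA eA scaler0 subr0.
- by move=> i iS; rewrite !mxE; apply: pos.
- by rewrite costB ec mulr0 subr0.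
Qed.

(** * Labels are constant along simplex paths *)

Section Labels.
Variable L : pred 'I_n.
Hypothesis cover : forall x S, feasible x -> rsupp x \subset S -> rows_thin S ->
  exists i, 1 <= x 0 i.
Hypothesis sep : forall x i j, feasible x -> 1 <= x 0 i -> 1 <= x 0 j -> L i = L j.

Lemma edge_label S x y i j : rows_thin S -> feasible x -> feasible y ->
  rsupp x \subset S -> rsupp y \subset S -> 1 <= x 0 i -> 1 <= y 0 j -> L i = L j.
Proof.
move=> thS [xA x0] [yA y0] xS yS.
pose z (t : F) := x + t *: (y - x).
have zE t l : z t 0 l = x 0 l + t * (y 0 l - x 0 l) by rewrite !mxE.
have zf t : 0 <= t <= 1 -> feasible (z t).
  case/andP=> t0 t1; split.
    by rewrite mulmxDl -scalemxAl mulmxBl xA yA subrr scaler0 addr0.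
  by move=> l; rewrite zE; have := x0 l; have := y0 l; nra.
apply: (@segment_label n L x y) => t t01.
  have [|l] := cover (zf t t01) (_ : rsupp (z t) \subset S) thS.
    apply/rsuppP => l lS; rewrite zE (rsuppP _ _ xS) ?(rsuppP _ _ yS) //.
    by rewrite subrr mulr0 addr0.
  by rewrite zE => zl; exists l.
by move=> l l'; rewrite -!zE; apply: sep; apply: zf.
Qed.

(** Each pivot follows an edge, which preserves the label by [edge_label], and strictly lowers the
    cost; the walk can only stop at [y]. *)
Lemma basic_label x y i j : feasible x -> rows_indep (rsupp x) ->
  feasible y -> rows_indep (rsupp y) -> 1 <= x 0 i -> 1 <= y 0 j -> L i = L j.
Proof.
move=> fx ix fy iy + yj; pose T := rsupp y.
(* A vertex is determined by its support, so the supports of the vertices of smaller cost form a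
   finite set that shrinks at every pivot. *)
pose lower x := [set S | decb (exists z,
  [/\ feasible z, rows_indep (rsupp z), rsupp z = S & cost T z < cost T x])].
have [l] := ubnP #|lower x|; elim: l x i fx ix => // l IH x i fx ix lt xi.
have [xy|nxy] := eqVneq x y; first by rewrite xy in xi; apply: sep yj.
have [[xA x0] [yA y0]] := (fx, fy).
have dA : (y - x) *m A = 0 by rewrite mulmxBl xA yA subrr.
have cy : cost T y = 0 by rewrite /cost big1 // => q; apply: rsupp_notin.
have cx : 0 < cost T x.
  rewrite lt_neqAle sumr_ge0 ?andbT // eq_sym; apply: contra nxy => cx0.
  rewrite eq_sym -subr_eq0; apply/eqP/iy => //; apply/rsuppP => q qT.
  rewrite !mxE (rsupp_notin qT) sub0r; apply/eqP; rewrite oppr_eq0.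
  by move: cx0; rewrite psumr_eq0 // => /allP/(_ q (mem_index_enum q)); rewrite qT.
have [||d [d'A d0 dc th]] := @edge_direction (rsupp x) T (y - x) ix dA.
- by move=> q /rsupp_notin xq; rewrite !mxE xq subr0.
- by rewrite -[x]scale1r costB cy mul1r sub0r oppr_lt0.
have [q0 dq0] : exists q, 0 < (- d) 0 q.
  apply: NNPP => no; move: dc; rewrite ltNge => /negP[].
  apply: sumr_ge0 => q _; rewrite leNgt; apply/negP => dq; apply: no.
  by exists q; rewrite mxE oppr_gt0.
have [|t [i1 [t0 _ di1 xi1 pos]]] := @ratio_test n predT x (- d) (fun q _ => x0 q).
  by exists q0.
pose x' := x - t *: (- d).
have fx' : feasible x'.
  split; first by rewrite mulmxBl -scalemxAl mulNmx d'A oppr0 scaler0 subr0.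
  by move=> q; rewrite !mxE; have := pos q isT; rewrite mxE.
have x'i1 : x' 0 i1 = 0 by rewrite !mxE xi1 mxE subrr.
have x'S : rsupp x' \subset rsupp x :|: rsupp d.
  apply/rsuppP => q; rewrite inE negb_or => /andP[/rsupp_notin xq /rsupp_notin dq].
  by rewrite !mxE xq dq oppr0 mulr0 subrr.
have dN0 : d 0 i1 != 0 by move: di1; rewrite mxE oppr_gt0 => /lt_eqF ->.
(* A relation on the support of [x'] is a multiple of the generator [u] and vanishes at [i1], where
   [u] does not because [d] does not. *)
have ix' : rows_indep (rsupp x').
  move=> e eA ex'; have [u thu] := th.
  have [c Ec] := thu e eA (subset_trans ex' x'S).
  have [c' Ec'] := thu d d'A (subsetUr _ _).
  have := rsuppP _ _ ex' i1; rewrite inE x'i1 eqxx => /(_ isT).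
  rewrite Ec mxE => /eqP; rewrite mulf_eq0 => /orP[/eqP ->|/eqP u0].
    by rewrite scale0r.
  by move: dN0; rewrite Ec' mxE u0 mulr0 eqxx.
(* There are no degenerate pivots: [d] is nonnegative wherever [x] vanishes, but negative at
   [i1]. *)
have t_gt0 : 0 < t.
  rewrite lt_neqAle t0 andbT eq_sym; apply/eqP => tz.
  have xi1z : x 0 i1 = 0 by rewrite xi1 tz mul0r.
  have := d0 i1; rewrite inE xi1z eqxx => /(_ isT).
  by move: di1; rewrite mxE oppr_gt0 leNgt => ->.
have cx' : cost T x' < cost T x.
  by rewrite costB costN mulrN opprK gtrDl pmulr_rlt0.
have [i2 x'i2] := cover fx' x'S th.
rewrite (edge_label th fx fx' (subsetUl _ _) x'S xi x'i2).
apply: (IH x') => //; apply: leq_trans (_ : #|lower x| <= l)%N => //.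
apply: proper_card; apply/properP; split.
  apply/subsetP => S; rewrite !inE => /decbP[z [fz iz zS cz]]; apply/decbP.
  by exists z; split=> //; apply: lt_trans cx'.
exists (rsupp x'); rewrite !inE; first by apply/decbP; exists x'.
apply/decbP => -[z [fz iz zS cz]]; suff E : z = x' by rewrite E ltxx in cz.
apply/eqP; rewrite -subr_eq0; apply/eqP/iz.
  by case: fz fx' => [zA _] [x'A _]; rewrite mulmxBl zA x'A subrr.
apply/rsuppP => q qz; have qx' : q \notin rsupp x' by rewrite -zS.
have -> : (z - x') 0 q = z 0 q - x' 0 q by rewrite !mxE.
by rewrite (rsupp_notin qz) (rsupp_notin qx') subrr.
Qed.

End Labels.
End BasicPoints.
End Polytope.

(** * The rank bound *)

(** Values of [f] on [S] outside the prefix are at most the last prefix value [t], those on the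
    prefix outside [S] are at least [t], and the latter are at least as many. *)
Lemma sum_prefix_max n (f : 'I_n -> nat) (S : {set 'I_n}) p :
  {homo f : i j / i <= j >-> j <= i} -> #|S| <= p <= n ->
  \sum_(i in S) f i <= \sum_(i < n | i < p) f i.
Proof.
move=> fdec /andP[Sp pn]; case: p Sp pn => [|p] Sp pn.
  by rewrite big_pred0 // => i; move: Sp; rewrite leqn0 cards_eq0 => /eqP ->; rewrite inE.
pose t := f (Ordinal pn); pose P := [set i : 'I_n | i < p.+1].
have cP : #|P| = p.+1.
  rewrite -sum1_card (eq_bigl (fun i : 'I_n => i < p.+1)) => [|i]; last by rewrite inE.
  by rewrite -(big_ord_widen n (fun=> 1%N) pn) sum1_card card_ord.
rewrite [leqRHS](eq_bigl (fun i => i \in P)); last by move=> i; rewrite inE.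
rewrite (big_setID P) /= [leqRHS](big_setID S) /= setIC leq_add2l.
apply: (@leq_trans (\sum_(i in S :\: P) t)).
  apply: leq_sum => i; rewrite !inE -leqNgt => /andP[/ltnW pi _]; exact: fdec.
apply: (@leq_trans (\sum_(i in P :\: S) t)).
  rewrite !sum_nat_const leq_mul2r -(leq_add2l #|S :&: P|) cardsID.
  by rewrite [in leqRHS]setIC cardsID cP Sp orbT.
by apply: leq_sum => i; rewrite !inE ltnS => /andP[_ ip]; apply: fdec.
Qed.

Section Rank.
Local Open Scope ring_scope.

Lemma rank_le_cols (F : fieldType) m n (B : 'M[F]_(m, n)) (J : {set 'I_n}) :
  (forall i j, j \notin J -> B i j = 0) -> (\rank B <= #|J|)%N.
Proof.
move=> B0; pose C : 'M_(m, #|J|) := colsub enum_val B.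
pose D : 'M[F]_(#|J|, n) := rowsub enum_val 1%:M.
have -> : B = C *m D.
  apply/matrixP => i j; rewrite mxE.
  under eq_bigr => q _ do rewrite !mxE.
  transitivity (\sum_(l in J) B i l * (l == j)%:R); last by rewrite big_enum_val.
  have [jJ|jJ] := boolP (j \in J).
    rewrite (bigD1 j) //= eqxx mulr1 big1 ?addr0 // => l /andP[_ /negbTE ->].
    by rewrite mulr0.
  rewrite big1 ?B0 // => l lJ; case: eqVneq => [lj|_]; last by rewrite mulr0.
  by move: jJ; rewrite -lj lJ.
exact: leq_trans (mxrankM_maxr _ _) (rank_leq_row _).
Qed.

(** The relations among the rows in [S] are multiples of one vector, so the left kernel has rank at
    most one. *)
Lemma thin_rank (F : realFieldType) n k (A : 'M[F]_(n, k)) (S : {set 'I_n}) :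
  rows_thin A S -> (#|S| <= (\rank (rowsub (enum_val : 'I_#|S| -> 'I_n) A)).+1)%N.
Proof.
case=> d thd; set B := rowsub _ A.
pose E : 'M[F]_(#|S|, n) := rowsub enum_val 1%:M.
have BE : B = E *m A by rewrite mul_rowsub_mx mul1mx.
pose d' : 'rV_#|S| := \row_p d 0 (enum_val p).
have uE (u : 'rV_#|S|) p : (u *m E) 0 (enum_val p) = u 0 p.
  rewrite mxE (bigD1 p) //= !mxE eqxx mulr1 big1 ?addr0 // => q qp.
  by rewrite !mxE (inj_eq enum_val_inj) (negbTE qp) mulr0.
have ker_d : (kermx B <= d')%MS.
  apply/rV_subP => u /sub_kermxP uB.
  have [||c Ec] := thd (u *m E); first by rewrite -mulmxA -BE.
    apply/rsuppP => i iS; rewrite mxE big1 // => p _; rewrite !mxE.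
    case: eqVneq => [pi|_]; last by rewrite mulr0.
    by move: iS; rewrite -pi enum_valP.
  suff -> : u = c *: d' by rewrite scalemx_sub.
  by apply/rowP => p; rewrite -uE Ec !mxE.
have := leq_trans (mxrankS ker_d) (rank_leq_row _).
by rewrite mxrank_ker; lia.
Qed.

(** * The polytope of rational factorizations *)

Definition vrow k (x : vec k) : 'rV[rat]_k := \row_j (x j)%:R.

Variables (G : zmodType) (k : nat) (h : 'I_k -> G) (atoms : seq (vec k)) (r : nat).
Hypothesis atoms_uniq : uniq atoms.
Hypothesis atomsP : forall a, a \in atoms <-> is_atom h a.
Hypothesis rank_r : is_rank h r.

Notation n := (size atoms).
Notation at_ i := (nth (vzero k) atoms i).

Definition atom_mx : 'M[rat]_(n, k) := \matrix_(i, j) (at_ i j)%:R.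

Lemma at_atom (i : 'I_n) : is_atom h (at_ i).
Proof. by apply/atomsP/mem_nth. Qed.

Lemma sum_atoms (V : nmodType) (F : vec k -> V) : \sum_(a <- atoms) F a = \sum_(i < n) F (at_ i).
Proof. by rewrite (big_nth (vzero k)) big_mkord. Qed.

Lemma fact_row z : is_fact h z ->
  feasible atom_mx (vrow (fsum z)) (\row_i (count_mem (at_ i) z)%:R).
Proof.
move=> zf; split=> [|i]; last by rewrite mxE ler0n.
apply/rowP => j; rewrite !mxE.
have <- : (\sum_(a <- atoms) count_mem a z * a j = fsum z j)%N.
  rewrite ffunE (@sum_count k (fun a => a j)) // => a /zf /atomsP //.
rewrite natr_sum sum_atoms; apply: eq_bigr => i _.
by rewrite !mxE natrM.
Qed.

Lemma vrow_sub b : inB h b -> (vrow b <= atom_mx)%MS.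
Proof.
move=> Bb; have [z [zf <-]] := exists_fact Bb.
by have [<- _] := fact_row zf; apply: submxMl.
Qed.

(** Multiplying a rational relation by the product [N] of its denominators gives the integral
    relation [c]. *)
Lemma Zindep_row_free s (v : 'I_s -> 'I_k -> int) :
  Zindep v -> row_free (\matrix_(i, j) ((v i j)%:~R : rat)).
Proof.
move=> vind; rewrite -kermx_eq0; apply/rowV0P => u /sub_kermxP uv.
pose N := \prod_i denq (u 0 i).
have N0 : N%:~R != 0 :> rat by rewrite intr_eq0; apply/prodf_neq0 => i _; apply: denq_neq0.
pose c i := numq (u 0 i) * \prod_(l | l != i) denq (u 0 l).
have cE i : (c i)%:~R = N%:~R * u 0 i.
  by rewrite /c /N [in RHS](bigD1 i) //= !intrM [RHS]mulrAC numqE [u 0 i * _]mulrC.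
have c0 := vind c; apply/rowP => i; rewrite mxE.
apply: (mulfI N0); rewrite mulr0 -cE c0 // => j.
apply/eqP; rewrite -(intr_eq0 rat) rmorph_sum /=; apply/eqP.
have := congr1 (fun w : 'rV_k => N%:~R * w 0 j) uv; rewrite !mxE mulr0 mulr_sumr => E.
by rewrite -[RHS]E; apply: eq_bigr => l _; rewrite rmorphM /= cE !mxE mulrA.
Qed.

(** Rationally independent atoms are independent over the integers. Conversely, every element of the
    monoid has a factorization, so its integral span lies in the row space. *)
Lemma rank_atom_mx : \rank atom_mx = r.
Proof.
case: rank_r => -[v [vspan vind]] maxr; apply/eqP; rewrite eqn_leq; apply/andP; split.
  rewrite leqNgt; apply/negP => lt.
  pose f := maxrankfun atom_mx; pose w (i : 'I_r.+1) := f (widen_ord lt i).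
  apply: (maxr (fun i j => (at_ (w i) j)%:Z)).
    move=> i; exists [:: (at_ (w i), 1)]; split=> [p|j].
      by rewrite inE => /eqP ->; case: (at_atom (w i)).
    by rewrite big_cons big_nil addr0 mul1r.
  move=> c cv i.
  pose u : 'rV[rat]_(\rank atom_mx) := \sum_l (c l)%:~R *: delta_mx 0 (widen_ord lt l).
  have u0 : u = 0.
    apply: (row_free_inj (maxrowsub_free atom_mx)); rewrite mul0mx mulmx_suml.
    apply/rowP => j; rewrite summxE !mxE.
    under eq_bigr => l _ do rewrite -scalemxAl -rowE !mxE.
    apply: etrans (congr1 (fun x : int => x%:~R : rat) (cv j)); rewrite rmorph_sum /=.
    by apply: eq_bigr => l _; rewrite rmorphM.
  have := congr1 (fun x : 'rV_(\rank atom_mx) => x 0 (widen_ord lt i)) u0.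
  rewrite summxE mxE (bigD1 i) //= big1 => [|l li].
    by rewrite !mxE !eqxx mulr1 addr0 => /eqP; rewrite intr_eq0 => /eqP.
  rewrite !mxE (_ : (widen_ord lt i == widen_ord lt l) = false) ?andbF ?mulr0 //.
  by rewrite -val_eqE /= val_eqE eq_sym (negbTE li).
have /eqP <- := Zindep_row_free vind; apply: mxrankS; apply/row_subP => i.
have [s [Bs vE]] := vspan i.
have -> : row i (\matrix_(i, j) (v i j)%:~R) = \sum_(p <- s) p.2%:~R *: vrow p.1.
  apply/rowP => j; rewrite !mxE vE rmorph_sum summxE; apply: eq_bigr => p _.
  by rewrite rmorphM /= !mxE.
rewrite big_seq; apply: summx_sub => p ps; apply: scalemx_sub.
exact/vrow_sub/Bs.
Qed.

Lemma feasible_coord b x j : feasible atom_mx (vrow b) x ->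
  (b j)%:R = \sum_i x 0 i * (at_ i j)%:R.
Proof.
case=> /rowP/(_ j) + _; rewrite !mxE => <-.
by apply: eq_bigr => i _; rewrite mxE.
Qed.

Lemma feasible_pair b x (i j : 'I_n) : feasible atom_mx (vrow b) x ->
  1 <= x 0 i -> 1 <= x 0 j -> i != j -> vle (vadd (at_ i) (at_ j)) b.
Proof.
move=> fx xi xj ij; have [_ x0] := fx; apply/vleP => l; rewrite ffunE.
rewrite -(ler_nat rat) (feasible_coord l fx) (bigD1 i) //= (bigD1 j) 1?eq_sym //=.
rewrite natrD addrA; apply: ler_wpDr.
  by apply: sumr_ge0 => q _; rewrite mulr_ge0.
by apply: lerD; rewrite -[leLHS]mul1r ler_wpM2r.
Qed.

(* [\sum_(i in S) a_i - b] is nonnegative, and positive at each coordinate of [J]. *)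
Lemma fractional_deg b x (S : {set 'I_n}) : feasible atom_mx (vrow b) x ->
  rsupp x \subset S -> (forall i, x 0 i < 1) ->
  exists2 J : {set 'I_k}, (vdeg b + #|J| <= \sum_(i in S) vdeg (at_ i))%N
    & forall i j, i \in S -> j \notin J -> at_ i j = 0%N.
Proof.
move=> fx xS x1; have [_ x0] := fx.
pose J := [set j | [exists i in S, (0 < at_ i j)%N]].
exists J; last first.
  move=> i j iS; rewrite inE => /exists_inPn/(_ i iS).
  by rewrite lt0n negbK => /eqP.
rewrite exchange_big /= -sum1_card big_mkcond /= -big_split /=; apply: leq_sum => j _.
have sumE : (\sum_(i in S) at_ i j)%:R - (b j)%:R
    = \sum_(i in S) (1 - x 0 i) * (at_ i j)%:R :> rat.
  rewrite (feasible_coord j fx) [X in _ - X](bigID (fun i => i \in S)) /=.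
  rewrite [X in _ - (_ + X)]big1 => [|i iS]; last by rewrite (rsuppP _ _ xS) ?mul0r.
  rewrite addr0 natr_sum -sumrB; apply: eq_bigr => i _.
  by rewrite mulrBl mul1r.
have term0 i : 0 <= (1 - x 0 i) * (at_ i j)%:R.
  by rewrite mulr_ge0 ?ler0n // subr_ge0 ltW.
case: ifP => [|_]; last first.
  by rewrite addn0 -(ler_nat rat) -subr_ge0 sumE sumr_ge0.
rewrite inE => /exists_inP[i iS ai].
rewrite addn1 -(ltr_nat rat) -subr_gt0 sumE (bigD1 i) //=; apply: ltr_wpDr.
  by apply: sumr_ge0.
by rewrite mulr_gt0 ?ltr0n // subr_gt0.
Qed.

(** The rows in [S] have rank at least [#|S| - 1], and at most both [r] and the number of columns
    they meet. Taking [.-1] in each summand puts the bound in the form required by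
    [sum_prefix_max]. *)
Lemma thin_deg b x (S : {set 'I_n}) : feasible atom_mx (vrow b) x ->
  rsupp x \subset S -> rows_thin atom_mx S -> (forall i, x 0 i < 1) ->
  (#|S| <= r.+1)%N /\ (vdeg b <= (\sum_(i in S) (vdeg (at_ i)).-1).+1)%N.
Proof.
move=> fx xS thS x1; have [J Jdeg J0] := fractional_deg fx xS x1.
have S1 := thin_rank thS.
have Sr : (#|S| <= r.+1)%N.
  by apply: leq_trans S1 _; rewrite ltnS -rank_atom_mx mxrankS // rowsub_sub.
split=> //; have SJ : (#|S| <= #|J|.+1)%N.
  apply: leq_trans S1 _; rewrite ltnS; apply: rank_le_cols => p j jJ.
  by rewrite !mxE J0 // enum_valP.
have : (\sum_(i in S) vdeg (at_ i) = \sum_(i in S) (vdeg (at_ i)).-1 + #|S|)%N.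
  rewrite -sum1_card -big_split /=; apply: eq_bigr => i _.
  by rewrite addn1 prednK // (atom_deg_gt0 (at_atom i)).
by move=> E; move: Jdeg; rewrite E; lia.
Qed.

Hypothesis atoms_sorted : sorted (fun a b : vec k => vdeg b <= vdeg a)%N atoms.

Lemma thin_bound b x (S : {set 'I_n}) : (r < n)%N -> feasible atom_mx (vrow b) x ->
  rsupp x \subset S -> rows_thin atom_mx S -> (forall i, x 0 i < 1) ->
  (vdeg b <= \sum_(a <- take r.+1 atoms) vdeg a - r)%N.
Proof.
move=> rn fx xS thS x1; have [Sr le] := thin_deg fx xS thS x1.
apply: leq_trans le _.
have mono : {homo (fun i : 'I_n => (vdeg (at_ i)).-1) : i j / (i <= j)%N >-> (j <= i)%N}.
  move=> i j ij; rewrite -!subn1 leq_sub2r //.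
  have tr : transitive (fun a b : vec k => vdeg b <= vdeg a)%N.
    by move=> u v w vu wv; apply: leq_trans wv vu.
  have rf : reflexive (fun a b : vec k => vdeg b <= vdeg a)%N by move=> u /=.
  by apply: (sorted_leq_nth tr rf (vzero k) atoms_sorted); rewrite ?inE.
have := @sum_prefix_max n (fun i => (vdeg (at_ i)).-1)%N S r.+1 mono.
rewrite Sr rn => /(_ isT).
(* Each of the [r + 1] terms gives up one unit and the successor in [thin_deg] restores one, which
   leaves [- r]. *)
have -> : (\sum_(a <- take r.+1 atoms) vdeg a
           = \sum_(i < n | i < r.+1) (vdeg (at_ i)).-1 + r.+1)%N.
  rewrite (big_nth (vzero k)) size_takel // big_mkord.
  rewrite (big_ord_widen n (fun i => vdeg (nth (vzero k) (take r.+1 atoms) i)) rn).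
  rewrite -[X in (_ + X)%N]card_ord -sum1_card (big_ord_widen n (fun=> 1%N) rn) -big_split /=.
  apply: eq_bigr => i ir.
  by rewrite nth_take // addn1 prednK // (atom_deg_gt0 (at_atom i)).
lia.
Qed.

Lemma cat_ok_rank :
  cat_ok h (\sum_(a <- take (minn n r.+1) atoms) vdeg a - r)%N.
Proof.
apply: cat_ok_of_connected => A z z' zf zf' E; move Eb: (fsum z) => b big Az Az'.
apply: NNPP => no.
have fz := fact_row zf; have fz' := fact_row zf'; rewrite -E Eb in fz'; rewrite Eb in fz.
have memz w (i : 'I_n) : (\row_i (count_mem (at_ i) w)%:R : 'rV[rat]_n) 0 i != 0 -> at_ i \in w.
  by rewrite mxE pnatr_eq0 -lt0n -has_pred1 has_count.
(* With at most [r] atoms the rows are independent, factorizations are unique up to order, and an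
   atom of [z] would also lie in [z']. *)
have [nr|rn] := leqP n r.
  have free : row_free atom_mx.
    by rewrite /row_free eqn_leq rank_leq_row rank_atom_mx.
  case: z zf Eb Az fz memz {E} => [|x z] zf Eb Az fz memz.
    by move: big; rewrite -Eb fsum_nil vdeg0.
  have xa : x \in atoms by apply/atomsP/zf; rewrite mem_head.
  pose i : 'I_n := Ordinal (etrans (index_mem x atoms) xa).
  have Ei : at_ i = x by rewrite nth_index.
  have := row_free_inj free (etrans fz.1 (esym fz'.1)).
  move/rowP/(_ i); rewrite !mxE Ei /= eqxx => Ec.
  have xz' : x \in z'.
    by rewrite -has_pred1 has_count -(ltr_nat rat) -Ec ltr_nat.
  by have := allP Az' _ xz'; rewrite /= (allP Az) // mem_head.
rewrite (minn_idPr rn) in big.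
pose L := [pred i : 'I_n | A (at_ i)].
have cover x (S : {set 'I_n}) : feasible atom_mx (vrow b) x -> rsupp x \subset S ->
    rows_thin atom_mx S -> exists i, 1 <= x 0 i.
  move=> fx xS thS; apply: NNPP => nx; move: big; rewrite ltnNge => /negP[].
  apply: (thin_bound rn fx xS thS) => i; rewrite ltNge; apply/negP => xi.
  by apply: nx; exists i.
have sep x i j : feasible atom_mx (vrow b) x -> 1 <= x 0 i -> 1 <= x 0 j -> L i = L j.
  move=> fx xi xj; have [->//|ij] := eqVneq i j.
  have le := feasible_pair fx xi xj ij; apply/idP/idP => /= Ai; apply: contraT => nA; case: no.
    by exists (at_ i), (at_ j); split=> //; apply: at_atom.
  by exists (at_ j), (at_ i); split; rewrite ?(vaddC (at_ j)) //; apply: at_atom.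
have [x [fx ix xz]] := exists_basic fz; have [y [fy iy yz]] := exists_basic fz'.
have [i xi] := cover x _ fx (subxx _) (rows_indep_thin ix).
have [j yj] := cover y _ fy (subxx _) (rows_indep_thin iy).
(* The vertex [x] was reached inside the support of [z], so its positive coordinates belong to atoms
   of [z]. *)
have Li : L i.
  apply: (allP Az); apply: memz; have := subsetP xz i.
  by rewrite !inE; apply; rewrite gt_eqF // (lt_le_trans ltr01).
have Lj : ~~ L j.
  apply: (allP Az'); apply: memz; have := subsetP yz j.
  by rewrite !inE; apply; rewrite gt_eqF // (lt_le_trans ltr01).
by move: Lj; rewrite -(basic_label cover sep fx ix fy iy xi yj) Li.
Qed.

End Rank.

(** * Combining the transfer, rank and Davenport bounds *)

Lemma supp_index (G : zmodType) m (g : 'I_m -> G) :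
  exists phi : 'I_m -> 'I_(size (supp g)), forall i, g i = suppf g (phi i).
Proof.
have lt i : index (g i) (supp g) < size (supp g).
  by rewrite index_mem mem_undup codom_f.
by exists (fun i => Ordinal (lt i)) => i; rewrite /suppf nth_index // -index_mem.
Qed.

Theorem theorem6p2 (G : zmodType) (m : nat) (g : 'I_m -> G)
    (atoms : seq (vec (size (supp g)))) (r : nat) :
  uniq atoms ->
  (forall a, a \in atoms <-> is_atom (suppf g) a) ->
  sorted (fun a b => vdeg b <= vdeg a) atoms ->
  is_rank (suppf g) r ->
  [/\ c_gr g <= maxn (2 * vdeg (head (vzero _) atoms)) (c_gr (suppf g)),
      c_gr (suppf g) <= \sum_(a <- take (minn (size atoms) r.+1) atoms) vdeg a - r
    & gen_finite g ->
      forall D, is_davenport (suppf g) D -> c_gr g <= 2 * D + 2].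
Proof.
move=> ua atomsP sa rk; have [phi gE] := supp_index g.
have ok := cat_ok_rank ua atomsP rk sa.
have headP a : is_atom (suppf g) a -> vdeg a <= vdeg (head (vzero _) atoms).
  move/atomsP; case: (atoms) sa => // x s /= sx; rewrite inE => /orP[/eqP -> //|].
  move: a; apply/allP; move: sx; rewrite path_sortedE; first by case/andP.
  by move=> u v w vu wv; apply: leq_trans wv vu.
have i_ : c_gr g <= maxn (2 * vdeg (head (vzero _) atoms)) (c_gr (suppf g)).
  apply: c_gr_le; apply: (cat_ok_transfer gE) (cat_ok_c_gr ok) => x xa.
  by rewrite -(vdeg_push phi); apply/headP/(atom_push gE).
split=> //; first exact: c_gr_le.
move=> _ D dav; apply: leq_trans i_ _; rewrite geq_max (c_gr_le (cat_ok_davenport dav)).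
rewrite andbT -mulnSr leq_mul2l /=.
(* Without atoms, [head] returns the zero vector, of degree 0; otherwise [2 * (D + 1)] bounds twice
   the largest degree. *)
case: (atoms) atomsP => [|a s] aP /=; first by rewrite vdeg0.
by apply: (davenport_atom_deg dav); apply/aP; rewrite mem_head.
Qed.
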